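(* Let $\rho\in(0,1]$ and $\theta>0$, and let $\nu^1_{\rho,\theta}$ be the one-dimensional $\Gamma$-grey measure, i.e. the unique probability measure on $(\mathbb{R},\mathcal{B}(\mathbb{R}))$ with $$\int_{\mathbb{R}}e^{ix\xi}\,d\nu^1_{\rho,\theta}(x)=\frac{\Gamma(\rho,\theta+\tfrac12\xi^2)}{\Gamma(\rho,\theta)},\qquad \xi\in\mathbb{R}.$$ Then all moments of $\nu^1_{\rho,\theta}$ are finite, the moments of odd order $k=2n+1$ ($n\ge 0$ an integer) are equal to zero, and for every even order $k=2n$ with $n\ge 1$ an integer, $$\int_{\mathbb{R}}x^{2n}\,d\nu^1_{\rho,\theta}(x)=\frac{(-1)^{n+1}(2n)!\,\Gamma(\rho)\,\theta^{\rho-n}}{n!\,2^n\,\Gamma(\rho,\theta)}\,E^{\rho}_{1,\rho+1-n}(-\theta).$$ Moreover, the first four polynomials $H_n^{\rho,\theta}$, $n=0,1,2,3$, with $\deg H_n^{\rho,\theta}=n$, obtained by applying Gram-Schmidt orthogonalization (without normalization, so that they are monic) to the monomials $1,x,x^2,x^3$ in $L^2(\mathbb{R},\nu^1_{\rho,\theta})$ are $$H_0^{\rho,\theta}(x)=1,\quad H_1^{\rho,\theta}(x)=x,\quad H_2^{\rho,\theta}(x)=x^2-\frac{\theta^{\rho-1}e^{-\theta}}{\Gamma(\rho,\theta)},\quad H_3^{\rho,\theta}(x)=x^3-3x\bigl(1+(1-\rho)\theta^{-1}\bigr).$$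
   Context: $\Gamma(\rho,x):=\int_x^{+\infty}e^{-w}w^{\rho-1}\,dw$ is the upper incomplete gamma function and $\Gamma(\cdot)$ is the gamma function. The three-parameter Mittag-Leffler (Prabhakar) function is $E^{\gamma}_{\alpha,\beta}(x):=\sum_{j=0}^{\infty}\frac{(\gamma)_j x^j}{j!\,\Gamma(\alpha j+\beta)}$, where $(\gamma)_j:=\Gamma(\gamma+j)/\Gamma(\gamma)$ and $1/\Gamma$ is taken to be $0$ at nonpositive integers. The existence of the probability measure $\nu^1_{\rho,\theta}$ follows from the complete monotonicity of $\eta\mapsto\Gamma(\rho,\theta+\eta)$ on $[0,\infty)$ together with Bernstein's theorem. *)

(* Defs.v *)
From mathcomp Require Import all_boot all_order all_algebra.
From mathcomp Require Import complex.
From mathcomp Require Import all_classical all_reals all_analysis.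

Set Implicit Arguments.
Unset Strict Implicit.
Unset Printing Implicit Defensive.

Import Order.TTheory GRing.Theory Num.Theory.
Import numFieldNormedType.Exports.

Local Open Scope classical_set_scope.
Local Open Scope ring_scope.
Local Open Scope complex_scope.

Section special_functions.
Context {R : realType}.
Implicit Types rho theta alpha beta gamma x : R.

Definition upper_gamma rho x : R :=
  \int[lebesgue_measure]_(w in `[x, +oo[) (expR (- w) * w `^ (rho - 1)).

(* Gamma on the whole real line: Euler's integral for x > 0, and
   Gamma (x + n) / (x (x + 1) ... (x + n - 1)) for x <= 0, where n is the least
   natural number with 0 < x + n. At a nonpositive integer the product vanishes,
   hence Gamma x = 0 and also (Gamma x)^-1 = 0, which is the usual convention
   for 1 / Gamma at its zeros. *)
Definition Gamma x : R :=
  if 0 < x then upper_gamma x 0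
  else let n := (Num.truncn (- x)).+1 in
    upper_gamma (x + n%:R) 0 / \prod_(i < n) (x + i%:R).

Definition pochhammer gamma (j : nat) : R := Gamma (gamma + j%:R) / Gamma gamma.

Definition prabhakar gamma alpha beta x : R :=
  limn (series (fun j : nat =>
    pochhammer gamma j * x ^+ j / (j`!%:R * Gamma (alpha * j%:R + beta)))).

End special_functions.

Section grey_measure.
Context {R : realType}.
Implicit Type nu : probability (measurableTypeR R) R.

Definition cexpi (t : R) : R[i] := cos t +i* sin t.

Definition char_fun nu (xi : R) : R[i] :=
  (\int[nu]_x complex.Re (cexpi (x * xi))) +i*
  (\int[nu]_x complex.Im (cexpi (x * xi))).

Definition is_gamma_grey (rho theta : R) nu : Prop :=
  forall xi : R,
    char_fun nu xi =
    (upper_gamma rho (theta + xi ^+ 2 / 2) / upper_gamma rho theta)%:C.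

Definition L2_inner nu (p q : {poly R}) : R := \int[nu]_x (p.[x] * q.[x]).

End grey_measure.

Section gram_schmidt.
Context {R : fieldType} {V : lmodType R}.
Variables (ip : V -> V -> R) (v : nat -> V).

Fixpoint gram_schmidt_seq (n : nat) : seq V :=
  if n is m.+1 then
    let s := gram_schmidt_seq m in
    rcons s (v m - \sum_(h <- s) (ip (v m) h / ip h h) *: h)
  else [::].

Definition gram_schmidt (n : nat) : V := nth 0 (gram_schmidt_seq n.+1) n.

End gram_schmidt.

Definition ortho_poly {R : realType} (nu : probability (measurableTypeR R) R)
    (n : nat) : {poly R} :=
  gram_schmidt (L2_inner nu) (fun k => 'X^k) n.

(* Main.v *)
(* The cosine transform of [nu] is phi(xi) = Gamma(rho, theta + xi^2/2) /
   Gamma(rho, theta) and its sine transform vanishes.  The Taylor remainders of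
   [cos] of order 2n are nonnegative up to sign and equivalent to x^(2n)/(2n)!.
   Integrating them against [nu] at the points x/(j+1) and comparing with the
   Taylor expansion of phi at 0 gives, inductively, the integrability of x^(2n)
   (Fatou) and the value of its integral (dominated convergence); the same
   remainders of [sin] kill the odd moments.  The Taylor coefficients of phi are
   the derivatives of Gamma(rho, .) at theta, i.e. those of t^(rho-1) e^(-t),
   which satisfy the same recurrence as the termwise derivatives of its power
   series; 1/Gamma(x) = x/Gamma(x+1) identifies that series with the Prabhakar
   function. *)
Require Import Defs.
From mathcomp Require Import all_boot all_order all_algebra.
From mathcomp Require Import complex.
From mathcomp Require Import all_classical all_reals all_analysis.
From mathcomp Require Import measurable_realfun.
From mathcomp Require Import ring lra.

Import Order.TTheory GRing.Theory Num.Theory.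
Import numFieldNormedType.Exports.

Local Open Scope classical_set_scope.
Local Open Scope ring_scope.

(** * The Euler integral and the upper incomplete gamma function *)

Section gamma_integral.
Context {R : realType}.
Notation mu := (@lebesgue_measure R).
Implicit Types (p s t w x y : R).

Definition gamma_density p w : R := expR (- w) * w `^ (p - 1).

Lemma gamma_density_ge0 p w : 0 <= gamma_density p w.
Proof. by rewrite mulr_ge0 ?expR_ge0 ?powR_ge0. Qed.

Lemma measurable_gamma_density p (D : set R) :
  measurable_fun D (gamma_density p).
Proof.
apply: measurable_funS (measurableT) (@subsetT _ _) _.
apply: measurable_funM; last exact: measurable_powR.
by apply: measurableT_comp => //; exact: measurable_expR.
Qed.

Lemma continuous_gamma_density p w : 0 < w ->
  {for w, continuous (gamma_density p)}.
Proof.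
move=> w0; apply: continuousM.
  apply: continuous_comp; first exact: continuousN.
  exact: continuous_expR.
apply: differentiable_continuous; apply/derivable1_diffP.
by apply: derivable_powR; rewrite in_itv/= w0.
Qed.

Lemma is_derive_expRN w : is_derive w 1 (fun w => - expR (- w)) (expR (- w)).
Proof.
have H : is_derive w 1 (expR \o -%R) (expR (- w) * - 1).
  exact: is_derive1_comp.
by have := is_deriveN H; rewrite mulrN1 opprK.
Qed.

(** Serves to dominate a gamma density of real exponent by two densities of integer exponent, whose
    integrals the recurrence controls. *)
Lemma powR_le1DX p (n : nat) w : 0 < p -> p <= n%:R -> 0 <= w ->
  w `^ p <= 1 + w ^+ n.
Proof.
move=> p0 pn w0; have [w1|w1] := leP w 1.
  apply: (@le_trans _ _ 1); last by rewrite lerDl exprn_ge0.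
  have := ge0_ler_powR (ltW p0) _ _ w1; rewrite powR1.
  by apply; rewrite nnegrE// ler01.
rewrite -powR_mulrn//; apply: (@le_trans _ _ (w `^ n%:R)).
  by apply: ler_powR => //; exact: ltW.
by rewrite lerDr.
Qed.

(** Boundary term at the upper end in the integration by parts. With an integer [m] above [p], the
    exponential dominates its Taylor term of order [m.+1], which leaves a bound of order [1 / n]. *)
Lemma cvg_powR_expRN p : 0 < p ->
  (n.+2%:R : R) `^ p * expR (- n.+2%:R) @[n --> \oo] --> (0 : R).
Proof.
move=> p0; pose m := (Num.truncn p).+1.
have pm : p <= m%:R by apply: ltW; exact: truncnS_gt.
apply: (@squeeze_cvgr _ _ _ _ (fun=> 0)
    (fun n => (m.+1`!%:R : R) * (n.+1%:R)^-1)).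
- apply: nearW => n; rewrite mulr_ge0 ?powR_ge0 ?expR_ge0//=.
  rewrite expRN ler_pdivrMr ?expR_gt0// mulrAC ler_pdivlMr ?ltr0n//.
  have n0 : 0 <= n.+2%:R :> R by rewrite ler0n.
  have := @expR_ge1Dxn R n.+2%:R m n0 => /(le_trans _) H.
  apply: (@le_trans _ _ (n.+2%:R ^+ m.+1)).
    rewrite exprSr; apply: ler_pM; rewrite ?powR_ge0 ?ler_nat//.
    rewrite -powR_mulrn//; apply: ler_powR => //.
    by rewrite ler1n.
  rewrite mulrC -ler_pdivrMr ?ltr0n ?fact_gt0//.
  by apply: H; rewrite lerDr.
- exact: cvg_cst.
- rewrite -[X in _ --> X](mulr0 (m.+1`!%:R : R)).
  by apply: cvgMr; exact: cvg_harmonic.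
Qed.

Lemma cvg_powR_harmonic p : 0 < p ->
  ((n.+1%:R : R)^-1) `^ p * expR (- (n.+1%:R : R)^-1) @[n --> \oo] --> (0 : R).
Proof.
move=> p0; apply: (@squeeze_cvgr _ _ _ _ (fun=> 0)
    (fun n => ((n.+1%:R : R)^-1) `^ p)).
- apply: nearW => n; rewrite mulr_ge0 ?powR_ge0 ?expR_ge0//=.
  by rewrite ler_piMr ?powR_ge0// expR_le1 oppr_le0 invr_ge0 ler0n.
- exact: cvg_cst.
- have /cvg_at_rightP := powR_cvg0 p0; apply; split.
    by move=> n; rewrite invr_gt0 ltr0n.
  exact: cvg_harmonic.
Qed.

End gamma_integral.

(** * Integration by parts for the gamma density on compact segments *)

Section gamma_recurrence.
Context {R : realType}.
Notation mu := (@lebesgue_measure R).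
Implicit Types (p s t w x y : R).

Lemma integrable_gamma_density_segment p (a b : R) : 0 < a ->
  mu.-integrable `[a, b] (EFin \o gamma_density p).
Proof.
move=> a0; apply: continuous_compact_integrable; first exact: segment_compact.
apply: continuous_in_subspaceT => x; rewrite inE/= in_itv/= => /andP[ax _].
by apply: continuous_gamma_density; exact: lt_le_trans ax.
Qed.

Lemma gamma_density_by_parts p (a b : R) : 0 < a -> a < b ->
  \int[mu]_(w in `[a, b]) gamma_density (p + 1) w =
  a `^ p * expR (- a) - b `^ p * expR (- b) +
  p * \int[mu]_(w in `[a, b]) gamma_density p w.
Proof.
move=> a0 ab.
have pos w : w \in `[a, b]%R -> 0 < w.
  by rewrite in_itv/= => /andP[aw _]; exact: lt_le_trans aw.
have poso w : w \in `]a, b[%R -> 0 < w.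
  by rewrite in_itv/= => /andP[aw _]; exact: lt_trans aw.
have cpow q w : 0 < w -> {for w, continuous (fun w => w `^ q)}.
  move=> w0; apply: differentiable_continuous; apply/derivable1_diffP.
  by apply: derivable_powR; rewrite in_itv/= w0.
have cexp w : {for w, continuous (fun w : R => expR (- w))}.
  apply: continuous_comp; first exact: continuousN.
  exact: continuous_expR.
have dpow w : w \in `]a, b[%R -> (fun w : R => w `^ p)^`()%classic w = p * w `^ (p - 1).
  move=> /poso w0; rewrite derive1E.
  by rewrite (@derive_val _ _ _ _ _ _ _ (is_derive1_powR p w0)).
have LR (F : R -> R) : (forall w, 0 < w -> derivable F w 1) ->
    derivable_oo_LRcontinuous F a b.
  move=> dF; have cF w : 0 < w -> {for w, continuous F}.
    by move=> /dF/derivable1_diffP; exact: differentiable_continuous.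
  split.
  - by move=> w /poso; exact: dF.
  - by apply: cvg_at_right_filter; exact: cF.
  - by apply: cvg_at_left_filter; apply: cF; exact: lt_trans ab.
have := @Rintegration_by_parts R (fun w => w `^ p) (fun w => - expR (- w))
  (fun w => p * w `^ (p - 1)) (fun w => expR (- w)) a b ab.
have -> : \int[mu]_(w in `[a, b]) gamma_density (p + 1) w =
    \int[mu]_(w in `[a, b]) (w `^ p * expR (- w)).
  by apply: eq_Rintegral => w _; rewrite /gamma_density addrK mulrC.
move=> ->.
- rewrite -RintegralZl//; last exact: integrable_gamma_density_segment.
  have -> : \int[mu]_(w in `[a, b]) (p * w `^ (p - 1) * - expR (- w)) =
      - \int[mu]_(w in `[a, b]) (p * gamma_density p w).
    rewrite -[RHS]mulN1r -[RHS]RintegralZl//.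
      by apply: eq_Rintegral => w _; rewrite /gamma_density; ring.
    have := @integrableZl _ _ _ mu _ (measurable_itv `[a, b]) p _
      (integrable_gamma_density_segment p a b a0).
    by apply: eq_integrable.
  ring.
- apply: continuous_in_subspaceT => w; rewrite inE/= => /pos w0.
  by apply: cvgM; [exact: cvg_cst|exact: cpow].
- apply: LR => w w0; apply: derivable_powR; by rewrite in_itv/= w0.
- by [].
- by apply: continuous_in_subspaceT => w _; exact: cexp.
- by apply: LR => w w0; case: (is_derive_expRN w).
- by move=> w _; rewrite derive1E; exact: (@derive_val _ _ _ _ _ _ _ (is_derive_expRN w)).
Qed.

End gamma_recurrence.

(** * The incomplete gamma function: finiteness, functional equation, positivity, derivative *)

Section gamma_finite.
Context {R : realType}.
Notation mu := (@lebesgue_measure R).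
Implicit Types (p s t w x y : R).

Let gamma_int p : \bar R :=
  (\int[mu]_(w in `]0%R, +oo[) (gamma_density p w)%:E)%E.

Let mE p (D : set R) : measurable_fun D (EFin \o gamma_density p).
Proof. by apply/measurable_EFinP; exact: measurable_gamma_density. Qed.

(** An exhaustion of the open half-line by segments away from the singularity at [0]. The upper end
    [n.+2] makes the segment nondegenerate already for [n = 0], as integration by parts requires. *)
Let segment (n : nat) : set R := `[n.+1%:R^-1, n.+2%:R].

Let segment_int (n : nat) p : R := \int[mu]_(w in segment n) gamma_density p w.

Let bigcup_segment : \bigcup_n segment n = `]0%R, +oo[%classic.
Proof.
apply/seteqP; split => x /=; rewrite /segment.
  move=> [n _] /=; rewrite !in_itv/= andbT => /andP[h _].
  by apply: lt_le_trans h; rewrite invr_gt0 ltr0n.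
rewrite in_itv/= andbT => x0.
exists (maxn (Num.truncn x) (Num.truncn x^-1)) => //=.
rewrite in_itv/=; apply/andP; split.
  rewrite -[leRHS]invrK lef_pV2 ?posrE ?ltr0n ?invr_gt0//.
  apply: (@le_trans _ _ (Num.truncn x^-1).+1%:R).
    by apply: ltW; exact: truncnS_gt.
  by rewrite ler_nat ltnS leq_maxr.
apply: (@le_trans _ _ (Num.truncn x).+1%:R).
  by apply: ltW; exact: truncnS_gt.
by rewrite ler_nat; apply: leq_trans (leqnSn _); rewrite ltnS leq_maxl.
Qed.

Let segment_gt0 n : 0 < (n.+1%:R : R)^-1. Proof. by rewrite invr_gt0 ltr0n. Qed.

Let EFin_segment_int n p :
  (segment_int n p)%:E = (\int[mu]_(w in segment n) (gamma_density p w)%:E)%E.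
Proof.
rewrite /segment_int /segment /Rintegral fineK//; apply: integrable_fin_num => //.
exact: (integrable_gamma_density_segment p _ n.+2%:R (segment_gt0 n)).
Qed.

Let segment_int_cvg p : (segment_int n p)%:E @[n --> \oo] --> gamma_int p.
Proof.
under eq_fun do rewrite EFin_segment_int.
rewrite /gamma_int -bigcup_segment; apply: ge0_nondecreasing_set_cvg_integral.
- move=> n m nm; rewrite subsetEset; apply: subset_itv => //=; rewrite bnd_simp.
    by rewrite lef_pV2 ?posrE ?ltr0n// ler_nat.
  by rewrite ler_nat !ltnS.
- by move=> n; exact: measurable_itv.
- by move=> n; apply/measurable_EFinP; exact: measurable_gamma_density.
- by move=> n x _; rewrite lee_fin gamma_density_ge0.
Qed.

(** Limit of the integration by parts along [segment]: both boundary terms vanish and monotone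
    convergence handles the integrals. Being an identity of extended reals, it does not presuppose
    finiteness and can be used to prove it. *)
Let gamma_intS p : 0 < p -> gamma_int (p + 1) = (p%:E * gamma_int p)%E.
Proof.
move=> p0; apply: (cvg_unique _ (segment_int_cvg (p + 1))) => //.
pose bd n := (n.+1%:R : R)^-1 `^ p * expR (- (n.+1%:R : R)^-1) -
  n.+2%:R `^ p * expR (- n.+2%:R).
rewrite (_ : (fun n => _) = (fun n => (bd n)%:E + p%:E * (segment_int n p)%:E)%E).
  rewrite -(add0e (p%:E * gamma_int p)%E); apply: cvgeD => //; last first.
    by apply: cvgeZl => //; exact: segment_int_cvg.
  apply: cvg_EFin; first exact: nearW.
  rewrite -[X in _ --> X](subr0 (0 : R)); apply: cvgB.
    exact: cvg_powR_harmonic.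
  exact: cvg_powR_expRN.
apply/funext => n; rewrite /segment_int gamma_density_by_parts//.
rewrite (@le_lt_trans _ _ 1) ?ltr1n// invf_le1 ?ler1n//.
Qed.

Let gamma_int_ge0 p : (0 <= gamma_int p)%E.
Proof. by apply: integral_ge0 => x _; rewrite lee_fin gamma_density_ge0. Qed.

Let gamma_int1 : gamma_int 1 = 1%E.
Proof.
have := @ge0_continuous_FTC2y R (fun w => expR (- w)) (fun w => - expR (- w)) 0 0.
rewrite /gamma_int => H.
under eq_integral do rewrite /gamma_density subrr powRr0 mulr1.
have mexp D : measurable_fun D (fun w : R => (expR (- w))%:E).
  apply/measurable_EFinP; apply: measurable_funS (measurableT) (@subsetT _ _) _.
  by apply: measurableT_comp => //; exact: measurable_expR.
have cexp w : {for w, continuous (fun w : R => expR (- w))}.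
  by apply: continuous_comp; [exact: continuousN|exact: continuous_expR].
rewrite integral_itv_obnd_cbnd// H.
- by rewrite oppr0 expR0 -EFinD sub0r opprK.
- by move=> *; exact: expR_ge0.
- exact: continuous_subspaceT.
- by rewrite -[X in _ --> X]oppr0; apply: cvgN; exact: cvgr_expR.
- by move=> x _; case: (is_derive_expRN x).
- by apply: cvg_at_right_filter; apply: cvgN; exact: cexp.
- by move=> w _; rewrite derive1E; exact: (@derive_val _ _ _ _ _ _ _ (is_derive_expRN w)).
Qed.

(** Integer exponents follow from exponent [1] by the recurrence, and exponent [p + 1] by domination
    with [1 + w ^+ m]. The recurrence then descends to [p], so the singularity at [0] needs no
    separate estimate. *)
Let gamma_int_fin p : 0 < p -> (gamma_int p < +oo)%E.
Proof.
have fin_nat (n : nat) : (gamma_int n.+1%:R < +oo)%E.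
  elim: n => [|n IH]; first by rewrite gamma_int1 ltry.
  rewrite -[n.+2]addn1 natrD gamma_intS//.
  by rewrite lte_mul_pinfty// lee_fin.
move=> p0; pose m := (Num.truncn p).+1.
have pm : p <= m%:R by apply: ltW; exact: truncnS_gt.
suff : (gamma_int (p + 1) < +oo)%E.
  rewrite gamma_intS//; case: (gamma_int p) (gamma_int_ge0 p) => [r _ _| |//].
    by rewrite ltry.
  by move=> _; rewrite gt0_muley.
apply: (@le_lt_trans _ _ (gamma_int 1 + gamma_int m.+1%:R)%E); last first.
  by rewrite lte_add_pinfty// (fin_nat 0%N).
rewrite -ge0_integralD//.
- apply: ge0_le_integral => //.
  + by move=> x _; rewrite lee_fin gamma_density_ge0.
  + exact: mE.
  + have := measurable_funD (@measurable_gamma_density R 1 `]0, +oo[%classic)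
      (measurable_gamma_density m.+1%:R `]0, +oo[%classic).
    by move/measurable_EFinP.
  + move=> x /=; rewrite in_itv/= andbT => x0.
    rewrite -EFinD lee_fin /gamma_density -mulrDr ler_wpM2l ?expR_ge0//.
    rewrite addrK subrr powRr0 -[m.+1]addn1 natrD addrK.
    by rewrite powR_mulrn ?powR_le1DX// ltW.
- by move=> x _; rewrite lee_fin gamma_density_ge0.
- exact: mE.
- by move=> x _; rewrite lee_fin gamma_density_ge0.
- exact: mE.
Qed.

Lemma integrable_gamma_density p : 0 < p ->
  mu.-integrable `[0%R, +oo[ (EFin \o gamma_density p).
Proof.
move=> p0; apply/integrableP; split.
  exact: mE.
under eq_integral do rewrite /= ger0_norm ?gamma_density_ge0//.
rewrite -integral_itv_obnd_cbnd; first exact: gamma_int_fin.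
exact: mE.
Qed.

Lemma upper_gamma0S p : 0 < p -> upper_gamma (p + 1) 0 = p * upper_gamma p 0.
Proof.
have E q : upper_gamma q 0 = fine (gamma_int q).
  congr fine; rewrite -integral_itv_obnd_cbnd//.
  exact: mE.
move=> p0; rewrite !E gamma_intS// fineM// ge0_fin_numE//.
exact: gamma_int_fin.
Qed.

Lemma upper_gamma_gt0 p x : 0 < p -> 0 <= x -> 0 < upper_gamma p x.
Proof.
move=> p0 x0.
have x1 : 0 < x + 1 by rewrite ltr_pwDr.
have x12 : x + 1 <= x + 2 by rewrite lerD2l ler1n.
(* A lower bound of the density on a unit segment that avoids [0] even when [x = 0]. The exponential
   is least at the right end; the power is least at one end or the other according to the sign of
   [p - 1]. *)
pose c := expR (- (x + 2)) * Num.min ((x + 1) `^ (p - 1)) ((x + 2) `^ (p - 1)).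
have c0 : 0 < c.
  rewrite mulr_gt0 ?expR_gt0// lt_min !powR_gt0//.
  exact: lt_le_trans x12.
have sub : `[x + 1, x + 2] `<=` `[x, +oo[.
  move=> w /=; rewrite !in_itv/= andbT => /andP[xw _]; apply: le_trans xw.
  by rewrite lerDl.
have itg : mu.-integrable `[x, +oo[ (EFin \o gamma_density p).
  apply: integrableS (integrable_gamma_density p p0) => //.
  by move=> w /=; rewrite !in_itv/= !andbT; exact: le_trans.
have mu1 : lebesgue_measure (`[x + 1, x + 2]%classic : set R) = 1%E.
  rewrite lebesgue_measure_itv/= lte_fin ltrD2l ltr1n -EFinD; congr EFin.
  lra.
apply: (lt_le_trans c0).
apply: (@le_trans _ _ (\int[mu]_(w in `[x + 1, x + 2]) c)).
  rewrite Rintegral_cst//= (_ : fine _ = 1) ?mulr1//.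
  exact: (congr1 fine mu1).
apply: (@le_trans _ _ (\int[mu]_(w in `[x + 1, x + 2]) gamma_density p w)).
  apply: le_Rintegral => //.
  - apply/integrableP; split.
      by apply/measurable_EFinP; exact: measurable_cst.
    by rewrite integral_cst//= (_ : mu _ = 1%E) ?mule1 ?ltry//; exact: mu1.
  - exact: integrableS itg.
  - move=> w /=; rewrite in_itv/= => /andP[w1 w2].
    rewrite /c /gamma_density ler_pM ?expR_ge0//.
      by rewrite le_min !powR_ge0.
      by rewrite ler_expR lerN2.
    have w0 : 0 < w by exact: lt_le_trans w1.
    rewrite ge_min; apply/orP; have [p1|p1] := leP 1 p.
      left; apply: ge0_ler_powR; rewrite ?nnegrE ?subr_ge0// ltW//.
    right; rewrite -(opprB 1 p) !powRN lef_pV2 ?posrE ?powR_gt0//.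
      apply: ge0_ler_powR; rewrite ?nnegrE ?subr_ge0//; try exact: ltW.
      by apply: ltW; exact: lt_le_trans x12.
    exact: lt_le_trans x12.
rewrite /Rintegral fine_le//.
- apply: integrable_fin_num => //; exact: integrableS itg.
- exact: integrable_fin_num.
- apply: ge0_subset_integral => //.
    exact: mE.
  by move=> w _; rewrite lee_fin gamma_density_ge0.
Qed.

(** Near [x] the function is the complete integral minus the integral over [[0, y]], to which the
    fundamental theorem of calculus applies. *)
Lemma is_derive_upper_gamma p x : 0 < p -> 0 < x ->
  is_derive x 1 (upper_gamma p) (- gamma_density p x).
Proof.
move=> p0 x0.
have itg := integrable_gamma_density p p0.
have [d1 d2] : derivable (fun y => \int[mu]_(w in `[0, y]) gamma_density p w) x 1
   /\ (fun y => \int[mu]_(w in `[0, y]) gamma_density p w)^`()%classic x =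
      gamma_density p x.
  apply: (@continuous_FTC1_closed R (gamma_density p) 0 x (x + 1)) => //.
  - by rewrite ltrDl.
  - apply: integrableS itg => //.
    by move=> w /=; rewrite !in_itv/= => /andP[-> _].
  - exact: continuous_gamma_density.
have E : is_derive x 1 (fun y => upper_gamma p 0 -
    \int[mu]_(w in `[0, y]) gamma_density p w) (- gamma_density p x).
  have D := derivableP d1; rewrite -derive1E d2 in D.
  have := is_deriveB (is_derive_cst (upper_gamma p 0) x 1) D.
  by rewrite sub0r.
apply: near_eq_is_derive E; near=> y.
have y0 : 0 < y by near: y; exact: lt_nbhsr.
rewrite [in RHS]/upper_gamma -Rintegral_itv_obnd_cbnd; last first.
  apply: integrableS itg => //.
  by move=> w /=; rewrite !in_itv/= !andbT => /ltW; apply: le_trans; exact: ltW.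
by rewrite -(@Rintegral_itvB R _ (BLeft 0) _ y itg)// bnd_simp ltW.
Unshelve. all: by end_near. Qed.

End gamma_finite.

(** * Derivatives of t^a e^(-t) and the Prabhakar function *)

Section Gamma_shift.
Context {R : realType}.
Implicit Types (a x y : R).

Lemma GammaE x : 0 < x -> Gamma x = upper_gamma x 0.
Proof. by rewrite /Gamma => ->. Qed.

Lemma Gamma_neq0 x : 0 < x -> Gamma x != 0.
Proof. by move=> x0; rewrite GammaE// gt_eqF// upper_gamma_gt0. Qed.

(* Stated for inverses, it also holds at the poles, where [Gamma x = 0]. *)
Lemma invGammaS x : (Gamma x)^-1 = x * (Gamma (x + 1))^-1.
Proof.
(* For [0 < x] this is the functional equation; for [-1 < x <= 0] the product in [Gamma] has the
   single factor [x]; for [x <= -1] the shifted arguments agree and the products at [x] and [x + 1]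
   differ by the factor [x]. *)
have [x0|x0] := ltP 0 x.
  rewrite !GammaE// ?addr_gt0// upper_gamma0S// invfM mulrA divff ?mul1r//.
  by rewrite gt_eqF.
rewrite {1}/Gamma ltNge x0/=.
have [x1|x1] := ltP 0 (x + 1).
  have -> : Num.truncn (- x) = 0%N by apply: truncn_def; apply/andP; split; lra.
  by rewrite big_ord1 addr0 invfM invrK mulrC GammaE.
rewrite /Gamma ltNge x1/=.
set n := Num.truncn (- (x + 1)).
have -> : Num.truncn (- x) = n.+1.
  have /truncn_itv/andP[n1 n2] : 0 <= - (x + 1) by lra.
  apply: truncn_def; rewrite -/n in n1 n2.
  rewrite -[in X in X && _]natr1 -[in X in _ && X]natr1 in n2 *.
  by apply/andP; split; lra.
rewrite big_ord_recl/= addr0 !invfM !invrK [in RHS]mulrCA; congr (_ * _).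
  by rewrite -addrA nat1r.
congr (_ * _); apply: eq_bigr => i _.
by rewrite /bump/= add1n -nat1r addrA.
Qed.

(** The falling factorial, that is, the factor produced by differentiating [t ^ a] [m] times. *)
Definition falling a (m : nat) : R := \prod_(i < m) (a - i%:R).

Lemma fallingS a m : falling a m.+1 = a * falling (a - 1) m.
Proof.
rewrite /falling big_ord_recl subr0; congr (_ * _).
by apply: eq_bigr => i _; rewrite -addrA -opprD nat1r.
Qed.

Lemma invGammaB y (m : nat) :
  (Gamma (y - m%:R))^-1 = falling (y - 1) m * (Gamma y)^-1.
Proof.
elim: m => [|m IH]; first by rewrite subr0 /falling big_ord0 mul1r.
rewrite invGammaS -[m.+1]addn1 natrD opprD addrA subrK IH.
by rewrite /falling addn1 big_ord_recr/=; ring.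
Qed.

End Gamma_shift.

(** * Iterated derivatives of [t ^ a * exp (- t)] and their power series *)

Section powexp_derivatives.
Context {R : realType}.
Implicit Types (a t : R).

(* The [m]-th derivative of [t ^ a * exp (- t)]. *)
Fixpoint powexp_deriv (m : nat) a t : R :=
  if m is m'.+1 then a * powexp_deriv m' (a - 1) t - powexp_deriv m' a t
  else expR (- t) * t `^ a.

Lemma is_derive_powexp_deriv m a t : 0 < t ->
  is_derive t 1 (powexp_deriv m a) (powexp_deriv m.+1 a t).
Proof.
move=> t0; elim: m a => [|m IH] a /=.
  have D1 : is_derive t 1 (expR \o -%R) (expR (- t) * - 1).
    exact: is_derive1_comp.
  have := is_deriveM D1 (is_derive1_powR a t0).
  by move=> H; apply: (is_derive_eq H); rewrite /GRing.scale/=; ring.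
have := is_deriveB (is_deriveZ a (IH (a - 1))) (IH a).
exact.
Qed.

(** The [m]-th derivative of the [j]-th term [(-1) ^ j * t ^ (a + j) / j!] of the expansion of
    [t ^ a * exp (- t)]. *)
Let term m a t (j : nat) : R :=
  (- t) ^+ j / j`!%:R * falling (a + j%:R) m * t `^ (a - m%:R).

(** No interchange of derivative and sum is needed: the series satisfies the recurrence that defines
    [powexp_deriv], starting from the exponential series. *)
Lemma series_powexp_deriv m a t : 0 < t ->
  series (term m a t) @ \oo --> powexp_deriv m a t.
Proof.
move=> t0; have t_neq0 : t != 0 by rewrite gt_eqF.
elim: m a => [|m IH] a /=.
  have -> : series (term 0 a t) = fun n => series (exp_coeff (- t)) n * t `^ a.
    apply/funext => n; rewrite /series/= mulr_suml; apply: eq_bigr => j _.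
    by rewrite /term /falling big_ord0 mulr1 subr0 /exp_coeff.
  apply: cvgMl; exact: is_cvg_series_exp_coeff.
(* In [term m.+1 a t j] the falling factorial has first factor [a + j]. The part with [a] is
   [a * term m (a - 1) t j]; in the other, [j] cancels against [j!] and leaves minus the preceding
   term of [term m a t], hence the shift. *)
pose v (j : nat) : R :=
  if j is j'.+1 then - term m a t j' else 0.
have -> : series (term m.+1 a t) =
    fun n => a * series (term m (a - 1) t) n + series v n.
  apply/funext => n; rewrite /series/= mulr_sumr -big_split/=.
  apply: eq_bigr => j _; rewrite /term fallingS.
  have -> : a + j%:R - 1 = a - 1 + j%:R by ring.
  have -> : a - m.+1%:R = a - 1 - m%:R by rewrite -natr1; ring.
  case: j => [|j]; first by rewrite /v /= !addr0; ring.
  rewrite /v /term.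
  have -> : a - 1 + j.+1%:R = a + j%:R by rewrite -natr1; ring.
  have -> : t `^ (a - m%:R) = t * t `^ (a - 1 - m%:R).
    rewrite -[X in X * _]powRr1 ?ltW// -powRD ?t_neq0 ?implybT//.
    by congr (_ `^ _); ring.
  rewrite factS natrM exprS.
  have j1 : j.+1%:R != 0 :> R by rewrite pnatr_eq0.
  have jf : j`!%:R != 0 :> R by rewrite pnatr_eq0 -lt0n fact_gt0.
  have -> : a + j.+1%:R = a + (1 + j%:R) by rewrite nat1r.
  rewrite -nat1r in j1 *.
  by field; rewrite ?j1 ?jf.
apply: cvgD; first by apply: cvgMr; exact: IH.
rewrite -(cvg_shiftS (series v)).
have -> : (fun n => series v n.+1) = - series (term m a t).
  apply/funext => n; rewrite /series/= big_nat_recl// add0r/=.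
  by rewrite sumrN.
exact: cvgN.
Qed.

(** Termwise, [Gamma (rho + j)] from the Pochhammer symbol cancels against the one that [invGammaB]
    extracts from [1 / Gamma (rho + j - m)], leaving the falling factorial of [term]. The index
    [m.+1] counts derivatives of the incomplete gamma function, whose first one is already
    [- powexp_deriv 0]. *)
Lemma prabhakar_powexp_deriv (rho theta : R) (m : nat) :
  0 < rho -> 0 < theta ->
  Gamma rho * theta `^ (rho - m.+1%:R) *
    prabhakar rho 1 (rho + 1 - m.+1%:R) (- theta) =
  powexp_deriv m (rho - 1) theta.
Proof.
move=> rho0 theta0; have tn : theta != 0 by rewrite gt_eqF.
set c := _ * theta `^ _.
have c0 : c != 0.
  by rewrite mulf_neq0 ?Gamma_neq0// powR_eq0 (negbTE tn).
have E : (fun j => pochhammer rho j * (- theta) ^+ j /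
    (j`!%:R * Gamma (1 * j%:R + (rho + 1 - m.+1%:R)))) =
    fun j => c^-1 * term m (rho - 1) theta j.
  apply/funext => j; rewrite /term.
  have -> : 1 * j%:R + (rho + 1 - m.+1%:R) = rho + j%:R - m%:R.
    by rewrite -natr1; ring.
  rewrite invfM invGammaB /c /pochhammer.
  have -> : rho - 1 + j%:R = rho + j%:R - 1 by ring.
  have -> : rho - m.+1%:R = rho - 1 - m%:R by rewrite -natr1; ring.
  have G1 := Gamma_neq0 rho rho0.
  have G2 : Gamma (rho + j%:R) != 0 by rewrite Gamma_neq0// ltr_wpDr.
  have P : theta `^ (rho - 1 - m%:R) != 0 by rewrite powR_eq0 (negbTE tn).
  have jf : j`!%:R != 0 :> R by rewrite pnatr_eq0 -lt0n fact_gt0.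
  by field; rewrite G1 G2 P jf.
rewrite /prabhakar E.
have -> : series (fun j => c^-1 * term m (rho - 1) theta j) =
    fun n => c^-1 * series (term m (rho - 1) theta) n.
  by apply/funext => n; rewrite /series/= mulr_sumr.
rewrite (cvg_lim _ (cvgMr (series_powexp_deriv _ _ _ theta0)))//.
by rewrite mulrA divff// mul1r.
Qed.

End powexp_derivatives.

(** * Taylor remainders *)

Section taylor_bound.
Context {R : realType}.
Implicit Types (a x y h : R).

Lemma is_derive_monomial (c : R) (k : nat) x :
  is_derive x 1 (fun h => c * h ^+ k) (c * (k%:R * x ^+ k.-1)).
Proof.
have H : is_derive x 1 (fun h : R => h ^+ k) (k%:R * x ^+ k.-1).
  apply: DeriveDef; first exact: exprn_derivable.
  by rewrite exp_derive /GRing.scale/= mulr1.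
exact: (is_deriveZ c H).
Qed.

(** Induction on the order: the remainder vanishes at [0] and its derivative is the remainder of one
    order less for the shifted family, so the mean value theorem gains a factor [h] with the same
    constant. *)
Lemma taylor_bound (n : nat) (f : nat -> R -> R) a :
  (forall k x, a <= x -> is_derive x 1 (f k) (f k.+1 x)) ->
  exists2 C : R, 0 <= C & forall h, 0 <= h <= 1 ->
    `|f 0%N (a + h) - \sum_(k < n) f k a / k`!%:R * h ^+ k| <= C * h ^+ n.
Proof.
elim: n f => [|n IH] f df.
  (* Order [0] only asks for a bound of [f 0] on the compact segment [[a, a + 1]]. *)
  have a1 : a <= a + 1 by rewrite lerDl.
  have cf : {within `[a, a + 1], continuous (fun x => `|f 0%N x|)}.
    apply: continuous_in_subspaceT => x; rewrite inE/= in_itv/= => /andP[ax _].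
    apply: (@continuous_comp _ _ _ (f 0%N) Num.norm); last exact: norm_continuous.
    apply: differentiable_continuous; apply/derivable1_diffP.
    by case: (df 0%N x ax).
  have [c _ hc] := EVT_max a1 cf.
  exists `|f 0%N c|; first exact: normr_ge0.
  move=> h /andP[h0 h1]; rewrite big_ord0 subr0 expr0 mulr1; apply: hc.
  by rewrite in_itv/= lerDl h0 lerD2l.
have [C C0 HC] := IH (fun k => f k.+1) (fun k x => df k.+1 x).
exists C => // h /andP[h0 h1].
pose r h := f 0%N (a + h) - \sum_(k < n.+1) f k a / k`!%:R * h ^+ k.
pose dr h := f 1%N (a + h) - \sum_(k < n) f k.+1 a / k`!%:R * h ^+ k.
have Dr x : 0 <= x -> is_derive x 1 r (dr x).
  move=> x0.
  have D1 : is_derive x 1 (fun h => f 0%N (a + h)) (f 1%N (a + x)).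
    have H1 : is_derive x 1 (fun h => a + h) 1.
      have := is_deriveD (is_derive_cst a x 1) (is_derive_id x 1).
      by rewrite add0r.
    have H2 : is_derive (a + x) 1 (f 0%N) (f 1%N (a + x)).
      by apply: df; rewrite lerDl.
    have := @is_derive1_comp _ (f 0%N) (fun h => a + h) x _ _ H2 H1.
    by rewrite mulr1.
  have D2 : is_derive x 1
      (\sum_(k < n.+1) (fun h : R => f k a / k`!%:R * h ^+ k))
      (\sum_(k < n.+1) f k a / k`!%:R * (k%:R * x ^+ k.-1)).
    apply: is_derive_sum => k.
    exact: is_derive_monomial.
  have := is_deriveB D1 D2.
  have -> : (fun h => f 0%N (a + h)) -
      \sum_(k < n.+1) (fun h : R => f k a / k`!%:R * h ^+ k) = r.
    by apply/funext => y; rewrite /r !fctE fct_sumE.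
  move=> H; apply: (is_derive_eq H); rewrite /dr; congr (_ - _).
  rewrite big_ord_recl/= mul0r mulr0 add0r; apply: eq_bigr => k _.
  rewrite /bump/= add1n factS natrM /=.
  have j1 : k.+1%:R != 0 :> R by rewrite pnatr_eq0.
  have jf : k`!%:R != 0 :> R by rewrite pnatr_eq0 -lt0n fact_gt0.
  by field; rewrite jf nat1r j1.
have r0 : r 0 = 0.
  rewrite /r addr0 big_ord_recl/= fact0 divr1 expr0 mulr1.
  rewrite big1 ?addr0 ?subrr// => k _.
  by rewrite expr0n/= mulr0.
have [c c0h E] : exists2 c, c \in `[0, h] & r h - r 0 = dr c * (h - 0).
  apply: MVT_segment => //.
    by move=> x; rewrite in_itv/= => /andP[x0 _]; apply: Dr; exact: ltW.
  apply: continuous_in_subspaceT => x; rewrite inE/= in_itv/= => /andP[x0 _].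
  apply: differentiable_continuous; apply/derivable1_diffP.
  by case: (Dr x x0).
rewrite r0 !subr0 in E; rewrite -/(r h) E normrM (ger0_norm h0) exprSr mulrA.
move: c0h; rewrite in_itv/= => /andP[c0 ch].
apply: ler_wpM2r => //; apply: le_trans (HC c _) _.
  by rewrite c0 (le_trans ch).
by rewrite ler_wpM2l// lerXn2r// nnegrE.
Qed.

End taylor_bound.

(** * Sign, size and asymptotics of the Taylor remainders of cosine and sine *)

Section trig_remainder.
Context {R : realType}.
Implicit Types (x y h : R).

(* Up to sign, the remainders of the Taylor expansions of [cos] (even [m]) and
   [sin] (odd [m]) at the origin, normalised so as to be equivalent to
   [y ^ m / m!]. *)
Fixpoint trig_rem (m : nat) y : R :=
  match m with
  | 0 => cos y
  | 1 => sin y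
  | m'.+2 => y ^+ m' / m'`!%:R - trig_rem m' y
  end.

Arguments trig_rem : simpl nomatch.

Lemma trig_remSS m y : trig_rem m.+2 y = y ^+ m / m`!%:R - trig_rem m y.
Proof. by []. Qed.

Lemma is_derive_trig_rem m y : is_derive y 1 (trig_rem m.+1) (trig_rem m y).
Proof.
have H (k : nat) : is_derive y 1 (trig_rem k.+1) (trig_rem k y) ->
    is_derive y 1 (trig_rem k.+3) (trig_rem k.+2 y).
  move=> IH.
  have D := is_deriveB (is_derive_monomial (k.+1`!%:R)^-1 k.+1 y) IH.
  have E : (fun z => (k.+1`!%:R)^-1 * z ^+ k.+1) - trig_rem k.+1 = trig_rem k.+3.
    by apply/funext => z; rewrite !fctE trig_remSS mulrC.
  rewrite -E; apply: (is_derive_eq D).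
  rewrite /= factS natrM.
  have j1 : k.+1%:R != 0 :> R by rewrite pnatr_eq0.
  have jf : k`!%:R != 0 :> R by rewrite pnatr_eq0 -lt0n fact_gt0.
  rewrite -nat1r in j1 *.
  by congr (_ - _); field; rewrite jf j1.
(* The recursion of [trig_rem] descends by two, so two consecutive orders are carried through the
   induction. *)
suff [//] : is_derive y 1 (trig_rem m.+1) (trig_rem m y) /\
  is_derive y 1 (trig_rem m.+2) (trig_rem m.+1 y).
elim: m => [|m [H1 H2]]; last by split => //; exact: H.
split; first exact: is_derive_sin.
have D := is_deriveB (is_derive_cst (1 : R) y 1) (is_derive_cos y).
have E : cst 1 - cos = trig_rem 2.
  by apply/funext => z; rewrite !fctE/= fact0 divr1.
by rewrite -E; apply: (is_derive_eq D); rewrite sub0r opprK.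
Qed.

Lemma trig_rem_at0 m : trig_rem m.+1 0 = 0.
Proof.
suff [//] : trig_rem m.+1 0 = 0 /\ trig_rem m.+2 0 = 0.
elim: m => [|m [H1 H2]]; first by rewrite /= sin0 cos0 fact0 divr1 subrr.
by split => //; rewrite trig_remSS H1 expr0n/= mul0r subrr.
Qed.

Lemma trig_remN m y : trig_rem m (- y) = (-1) ^+ m * trig_rem m y.
Proof.
suff [//] : trig_rem m (- y) = (-1) ^+ m * trig_rem m y /\
  trig_rem m.+1 (- y) = (-1) ^+ m.+1 * trig_rem m.+1 y.
elim: m => [|m [H1 H2]]; first by rewrite /= cosN sinN expr0 expr1 mul1r mulN1r.
split => //; rewrite !trig_remSS H1 (exprNn y) !exprS.
by move: ((-1) ^+ m) => s; ring.
Qed.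

Lemma continuous_trig_rem m : continuous (trig_rem m).
Proof.
case: m => [|m] y; first exact: continuous_cos.
apply: differentiable_continuous; apply/derivable1_diffP.
by case: (is_derive_trig_rem m y).
Qed.

Lemma trig_rem_MVT m y : 0 <= y ->
  exists2 c, 0 <= c <= y & trig_rem m.+1 y = trig_rem m c * y.
Proof.
move=> y0.
have [c] : exists2 c, c \in `[0, y] &
    trig_rem m.+1 y - trig_rem m.+1 0 = trig_rem m c * (y - 0).
  apply: MVT_segment => //.
    by move=> x _; exact: is_derive_trig_rem.
  by apply: continuous_subspaceT; exact: continuous_trig_rem.
by rewrite in_itv/= trig_rem_at0 !subr0 => cy E; exists c.
Qed.

(** Starts from [1 - cos y >= 0]; each order is the derivative of the next, which vanishes at
    [0]. *)
Lemma trig_rem_ge0 m y : 0 <= y -> 0 <= trig_rem m.+2 y.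
Proof.
elim: m y => [|m IH] y y0.
  by rewrite /= fact0 divr1 expr0 subr_ge0 cos_le1.
have [c /andP[c0 _] ->] := trig_rem_MVT m.+2 y y0.
by rewrite mulr_ge0// IH.
Qed.

(** By parity take [y >= 0]. From order [2] on the remainder is nonnegative, and nonnegativity two
    orders higher is exactly the upper bound; orders [0] and [1] follow from the bound on [cos]. *)
Lemma norm_trig_rem_le m y : `|trig_rem m y| <= `|y| ^+ m / m`!%:R.
Proof.
wlog y0 : y / 0 <= y.
  move=> H; have [/H//|/ltW y0] := leP 0 y.
  rewrite -(opprK y) trig_remN normrM normrX normrN1 expr1n mul1r normrN.
  by apply: H; rewrite oppr_ge0.
rewrite (ger0_norm y0); have U := trig_rem_ge0 m y y0.
case: m U => [|[|m]] U.
- by rewrite fact0 expr0 divr1 cos_max.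
- have [c _ ->] := trig_rem_MVT 0 y y0.
  rewrite normrM (ger0_norm y0) expr1 (_ : 1`!%:R = 1 :> R)// divr1 -[leRHS]mul1r.
  by rewrite ler_wpM2r//= cos_max.
- by rewrite ger0_norm ?trig_rem_ge0// -subr_ge0.
Qed.

Lemma trig_rem_even_ge0 n y : (0 < n)%N -> 0 <= trig_rem (2 * n) y.
Proof.
case: n => // n _; rewrite mulnS.
have [|/ltW] := leP 0 y; first exact: trig_rem_ge0.
rewrite -oppr_ge0 => /(trig_rem_ge0 (2 * n)).
by rewrite trig_remN !exprS exprM sqrrN !expr1n mulr1 mulrNN !mul1r.
Qed.

(** The difference from the limit is the remainder of order [m.+2] divided by [h j ^+ m], hence of
    size [h j ^+ 2]. *)
Lemma cvg_trig_rem m x :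
  trig_rem m (x * (j.+1%:R)^-1) / (j.+1%:R)^-1 ^+ m @[j --> \oo] -->
  x ^+ m / m`!%:R.
Proof.
pose h j : R := (j.+1%:R)^-1.
have h0 j : 0 < h j by rewrite invr_gt0 ltr0n.
have h1 j : h j <= 1 by rewrite invf_le1 ?ltr0n// ler1n.
have E j : trig_rem m (x * h j) / h j ^+ m =
    x ^+ m / m`!%:R - trig_rem m.+2 (x * h j) / h j ^+ m.
  have hm : h j ^+ m != 0 by rewrite expf_neq0// gt_eqF.
  have jf : m`!%:R != 0 :> R by rewrite pnatr_eq0 -lt0n fact_gt0.
  by rewrite trig_remSS exprMn; field; rewrite hm jf.
rewrite (_ : (fun j => _) = (fun j => x ^+ m / m`!%:R -
   trig_rem m.+2 (x * h j) / h j ^+ m)); last by apply/funext => j; exact: E.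
rewrite -[X in _ --> X]subr0; apply: cvgB; first exact: cvg_cst.
apply/norm_cvg0P; apply: (@squeeze_cvgr _ _ _ _ (fun=> 0)
    (fun j => `|x| ^+ m.+2 / m.+2`!%:R * h j)).
- apply: nearW => j; rewrite normr_ge0 andTb normrM normfV normrX (gtr0_norm (h0 j)).
  rewrite ler_pdivrMr ?exprn_gt0//; apply: le_trans (norm_trig_rem_le _ _) _.
  rewrite normrM (gtr0_norm (h0 j)) exprMn.
  set X := `|x| ^+ m.+2; set F := m.+2`!%:R.
  have -> : X * h j ^+ m.+2 / F = X / F * h j * h j ^+ m * h j.
    by rewrite !exprS; ring.
  have X0 : 0 <= X by apply: exprn_ge0.
  have hj0 := ltW (h0 j).
  apply: ler_piMr (h1 j); apply: mulr_ge0; last exact: exprn_ge0.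
  by apply: mulr_ge0 => //; apply: divr_ge0 => //; exact: ler0n.
- exact: cvg_cst.
- rewrite -[X in _ --> X](mulr0 (`|x| ^+ m.+2 / m.+2`!%:R)).
  by apply: cvgMr; exact: cvg_harmonic.
Qed.

End trig_remainder.

(** * Moments from the cosine transform *)

Section moments.
Context {R : realType} (nu : probability (measurableTypeR R) R).
Implicit Types (x h xi : R).

Let integrable (f : R -> R) : Prop := nu.-integrable [set: R] (EFin \o f).
Let h_ (j : nat) : R := (j.+1%:R)^-1.

Let h_gt0 j : 0 < h_ j. Proof. by rewrite invr_gt0 ltr0n. Qed.
Let h_le1 j : h_ j <= 1. Proof. by rewrite invf_le1 ?ltr0n// ler1n. Qed.

Let integrableZ (a : R) (f : R -> R) : integrable f ->
  integrable (fun x => a * f x).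
Proof. exact: integrableZl. Qed.

Let continuous_integrable_bounded (f : R -> R) (M : R) : continuous f ->
  (forall x, `|f x| <= M) -> integrable f.
Proof.
move=> cf fM; have mf : measurable_fun [set: R] f by exact: continuous_measurable_fun.
apply: (@le_integrable _ _ _ nu _ measurableT _ (EFin \o cst M)).
- exact/measurable_EFinP.
- move=> x _ /=; rewrite lee_fin; apply: le_trans (fM x) _; exact: ler_norm.
- exact: finite_measure_integrable_cst.
Qed.

Let measurable_trig_rem m h :
  measurable_fun [set: measurableTypeR R] (fun x : R => trig_rem m (x * h)).
Proof.
apply: continuous_measurable_fun => x.
apply: (@continuous_comp _ _ _ (fun x => x * h)); first exact: mulrr_continuous.
exact: continuous_trig_rem.
Qed.

Let measurable_exprn k :
  measurable_fun [set: measurableTypeR R] (fun x : R => x ^+ k).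
Proof. by apply: continuous_measurable_fun; exact: exprn_continuous. Qed.

Lemma integrable_trig h :
  integrable (fun x => cos (x * h)) /\ integrable (fun x => sin (x * h)).
Proof.
split.
  apply: (continuous_integrable_bounded _ 1) => x; last exact: cos_max.
  apply: (@continuous_comp _ _ _ (fun x => x * h)); first exact: mulrr_continuous.
  exact: continuous_cos.
apply: (continuous_integrable_bounded _ 1) => x; last exact: sin_max.
apply: (@continuous_comp _ _ _ (fun x => x * h)); first exact: mulrr_continuous.
exact: continuous_sin.
Qed.

Let trig_rem_integralS m h :
  integrable (fun x => x ^+ m) -> integrable (fun x => trig_rem m (x * h)) ->
  integrable (fun x => trig_rem m.+2 (x * h)) /\
  \int[nu]_x trig_rem m.+2 (x * h) =
    h ^+ m * ((\int[nu]_x (x ^+ m)) / m`!%:R) - \int[nu]_x trig_rem m (x * h).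
Proof.
move=> im it; pose a := h ^+ m / m`!%:R.
have E : (fun x => trig_rem m.+2 (x * h)) =
    (fun x => a * x ^+ m - trig_rem m (x * h)).
  by apply/funext => x; rewrite trig_remSS exprMn /a; ring.
rewrite E; have ia := integrableZ a _ im; split.
  exact: (integrableB measurableT ia it).
rewrite RintegralB// RintegralZl// /a; congr (_ - _); ring.
Qed.

(** Dominated convergence: [norm_trig_rem_le] bounds every rescaled remainder by the absolute value
    of its pointwise limit. *)
Let cvg_trig_rem_integral m :
  integrable (fun x => x ^+ m) ->
  (forall h, integrable (fun x => trig_rem m (x * h))) ->
  (\int[nu]_x trig_rem m (x * h_ j)) / h_ j ^+ m @[j --> \oo] -->
    (\int[nu]_x (x ^+ m)) / m`!%:R.
Proof.
move=> im it.
have E j : (\int[nu]_x trig_rem m (x * h_ j)) / h_ j ^+ m =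
    \int[nu]_x (trig_rem m (x * h_ j) / h_ j ^+ m).
  by rewrite RintegralZr//; exact: it.
have E2 : (\int[nu]_x (x ^+ m)) / m`!%:R = \int[nu]_x (x ^+ m / m`!%:R).
  by rewrite RintegralZr//; exact: im.
rewrite E2; under eq_fun do rewrite E.
have iZ : integrable (fun x => x ^+ m / m`!%:R).
  under [X in integrable X]eq_fun do rewrite mulrC.
  exact: (integrableZ _ _ im).
apply: fine_cvg; rewrite fineK; last exact: integrable_fin_num.
apply: (@dominated_cvg _ _ _ nu _ measurableT _ _
  (fun x => (`|x ^+ m / m`!%:R|)%:E)).
- move=> j; apply/measurable_EFinP.
  apply: measurable_funM; last exact: measurable_cst.
  exact: measurable_trig_rem.
- by move=> x _; apply: cvg_EFin; [exact: nearW|exact: cvg_trig_rem].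
- by [].
- exact: (integrable_abse iZ).
- move=> j x _ /=; rewrite lee_fin normrM normfV [`|h_ j ^+ m|]gtr0_norm ?exprn_gt0//.
  rewrite ler_pdivrMr ?exprn_gt0//; apply: le_trans (norm_trig_rem_le _ _) _.
  rewrite [in leRHS]normrM normfV normrX (@ger0_norm _ m`!%:R)// normrM exprMn.
  by rewrite (gtr0_norm (h_gt0 j)) mulrAC.
Qed.

(** Fatou's lemma for the rescaled remainders, nonnegative because of even order; of [l] only the
    finiteness matters. Order [0] is apart since [cos] changes sign. *)
Let integrable_exprn_even n (l : R) :
  (forall h, integrable (fun x => trig_rem (2 * n) (x * h))) ->
  (\int[nu]_x trig_rem (2 * n) (x * h_ j)) / h_ j ^+ (2 * n) @[j --> \oo] --> l ->
  integrable (fun x => x ^+ (2 * n)).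
Proof.
case: n => [|n] it itl.
  under [X in integrable X]eq_fun do rewrite expr0.
  exact: finite_measure_integrable_cst.
set m := (2 * n.+1)%N in it itl *.
have Fm : m`!%:R != 0 :> R by rewrite pnatr_eq0 -lt0n fact_gt0.
suff iZ : integrable (fun x => x ^+ m / m`!%:R).
  have -> : (fun x => x ^+ m) = (fun x => m`!%:R * (x ^+ m / m`!%:R)).
    by apply/funext => x; rewrite mulrC divfK.
  exact: (integrableZ _ _ iZ).
pose g j x := (trig_rem m (x * h_ j) / h_ j ^+ m)%:E.
have mg j : measurable_fun [set: measurableTypeR R] (g j).
  apply/measurable_EFinP; apply: measurable_funM; last exact: measurable_cst.
  exact: measurable_trig_rem.
have g0 j x : (0 <= g j x)%E.
  by rewrite lee_fin divr_ge0 ?exprn_ge0 ?(ltW (h_gt0 j))// trig_rem_even_ge0.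
have := fatou nu measurableT mg (fun j x _ => g0 j x).
have -> : (fun x => limn_einf (g^~ x)) = (fun x => (x ^+ m / m`!%:R)%:E).
  apply/funext => x.
  have C : g j x @[j --> \oo] --> (x ^+ m / m`!%:R)%:E.
    by apply: cvg_EFin; [exact: nearW|exact: cvg_trig_rem].
  by rewrite (cvg_limn_einf_sup C).
have -> : limn_einf (fun j => \int[nu]_x g j x)%E = l%:E.
  have C : (\int[nu]_x g j x)%E @[j --> \oo] --> l%:E.
    have -> : (fun j => \int[nu]_x g j x)%E =
        (fun j => ((\int[nu]_x trig_rem m (x * h_ j)) / h_ j ^+ m)%:E).
      apply/funext => j; have -> : (\int[nu]_x trig_rem m (x * h_ j)) / h_ j ^+ m =
          \int[nu]_x (trig_rem m (x * h_ j) / h_ j ^+ m).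
        by rewrite RintegralZr//; exact: it.
      rewrite /Rintegral fineK//.
      apply: integrable_fin_num => //.
      under [X in nu.-integrable _ X]eq_fun do rewrite mulrC.
      exact: (integrableZ _ _ (it (h_ j))).
    by apply: cvg_EFin; first exact: nearW.
  by rewrite (cvg_limn_einf_sup C).
move=> le_l; apply/integrableP; split.
  apply/measurable_EFinP; apply: measurable_funM; last exact: measurable_cst.
  exact: measurable_exprn.
apply: le_lt_trans (ltry l); apply: le_trans le_l.
rewrite le_eqVlt; apply/orP; left; apply/eqP; apply: eq_integral => x _ /=.
by rewrite ger0_norm// divr_ge0// /m exprM exprn_ge0// sqr_ge0.
Qed.

(** * Moments read off the Taylor coefficients of the cosine transform *)

Section cosine_transform.
Variables (phi : R -> R) (c : nat -> R).
Hypothesis cos_phi : forall xi, \int[nu]_x cos (x * xi) = phi xi.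
Hypothesis sin_phi : forall xi, \int[nu]_x sin (x * xi) = 0.
Hypothesis phi_taylor : forall n, exists2 C : R, 0 <= C &
  forall h, 0 <= h <= 1 ->
  `|phi h - \sum_(k < n) c k * h ^+ (2 * k)| <= C * h ^+ (2 * n).

Let cvg_taylor_quotient n :
  (phi (h_ j) - \sum_(k < n) c k * h_ j ^+ (2 * k)) / h_ j ^+ (2 * n)
    @[j --> \oo] --> c n.
Proof.
(* One order further than the sum subtracted: the additional term gives the limit [c n], and the
   error divided by [h_ j ^+ (2 * n)] is at most [C * h_ j ^+ 2]. *)
have [C C0 HC] := phi_taylor n.+1.
apply/subr_cvg0/norm_cvg0P.
apply: (@squeeze_cvgr _ _ _ _ (fun=> 0) (fun j => C * h_ j)).
- apply: nearW => j; rewrite normr_ge0 andTb.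
  have hn : 0 < h_ j ^+ (2 * n) by rewrite exprn_gt0.
  have hn0 : h_ j ^+ (2 * n) != 0 by rewrite gt_eqF.
  have := HC (h_ j); rewrite ltW//= h_le1 => /(_ isT).
  rewrite big_ord_recr/= mulnS exprD => le_C.
  rewrite -(ler_pM2r hn) -[X in _ * X <= _](gtr0_norm hn) -normrM mulrBl divfK//.
  rewrite -addrA -opprD; apply: le_trans le_C _.
  rewrite mulrA ler_wpM2r ?(ltW hn)// ler_wpM2l// expr2.
  by rewrite ler_piMr// ltW.
- exact: cvg_cst.
- rewrite -[X in _ --> X](mulr0 C); apply: cvgMr; exact: cvg_harmonic.
Qed.

Lemma even_moment n : integrable (fun x => x ^+ (2 * n)) /\
  \int[nu]_x (x ^+ (2 * n)) = (-1) ^+ n * (2 * n)`!%:R * c n.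
Proof.
(* The induction also carries the transform of the remainder, which up to sign is the Taylor
   remainder of [phi]. By [step] it yields the moment of order [2 * k], whose existence makes the
   next remainder integrable. *)
suff : (integrable (fun x => x ^+ (2 * n)) /\
    \int[nu]_x (x ^+ (2 * n)) = (-1) ^+ n * (2 * n)`!%:R * c n) /\
  forall h, integrable (fun x => trig_rem (2 * n) (x * h)) /\
    \int[nu]_x trig_rem (2 * n) (x * h) =
      (-1) ^+ n * (phi h - \sum_(k < n) c k * h ^+ (2 * k)) by case.
have step k : (forall h, integrable (fun x => trig_rem (2 * k) (x * h)) /\
    \int[nu]_x trig_rem (2 * k) (x * h) =
      (-1) ^+ k * (phi h - \sum_(i < k) c i * h ^+ (2 * i))) ->
    integrable (fun x => x ^+ (2 * k)) /\
    (\int[nu]_x (x ^+ (2 * k))) / (2 * k)`!%:R = (-1) ^+ k * c k.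
  move=> Hk.
  have it h : integrable (fun x => trig_rem (2 * k) (x * h)) by case: (Hk h).
  have L : (\int[nu]_x trig_rem (2 * k) (x * h_ j)) / h_ j ^+ (2 * k)
      @[j --> \oo] --> (-1) ^+ k * c k.
    under eq_fun do rewrite (Hk _).2 -mulrA.
    by apply: cvgMr; exact: cvg_taylor_quotient.
  have ik := integrable_exprn_even _ _ it L; split => //.
  exact: (cvg_unique (@Rhausdorff R) (cvg_trig_rem_integral _ ik it) L).
have H : forall h, integrable (fun x => trig_rem (2 * n) (x * h)) /\
    \int[nu]_x trig_rem (2 * n) (x * h) =
      (-1) ^+ n * (phi h - \sum_(k < n) c k * h ^+ (2 * k)).
  elim: n => [|n IH] h.
    split; first by case: (integrable_trig h).
    by rewrite big_ord0 subr0 mul1r -cos_phi.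
  have [ik Ek] := step _ IH; have [it Et] := IH h.
  have [it2 Et2] := trig_rem_integralS _ _ ik it.
  rewrite mulnS; split; first exact: it2.
  by rewrite Et2 Ek Et big_ord_recr/= exprS; ring.
have [ik Ek] := step _ H; split; [split => //|exact: H].
by rewrite mulrAC -Ek divfK// pnatr_eq0 -lt0n fact_gt0.
Qed.

Lemma integrable_exprn k : integrable (fun x => x ^+ k).
Proof.
have i1 : integrable (fun x => 1 + x ^+ (2 * k)).
  exact: (@integrableD _ _ _ nu _ measurableT _ _
    (finite_measure_integrable_cst nu 1 measurableT) (even_moment k).1).
apply: (@le_integrable _ _ _ nu _ measurableT _ _ _ _ i1).
  by apply/measurable_EFinP; exact: measurable_exprn.
move=> x _ /=; rewrite lee_fin mulnC exprM.
rewrite [leRHS]ger0_norm ?addr_ge0 ?sqr_ge0// -[(x ^+ k) ^+ 2]real_normK ?num_real//.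
have := sqr_ge0 (`|x ^+ k| - 1); have := normr_ge0 (x ^+ k); nra.
Qed.

(** Odd remainders change sign, so Fatou's lemma is replaced by the integrability obtained from the
    even moments; every transform in the induction is then [0]. *)
Lemma odd_moment n : \int[nu]_x (x ^+ (2 * n).+1) = 0.
Proof.
suff [//] : \int[nu]_x (x ^+ (2 * n).+1) = 0 /\
  forall h, integrable (fun x => trig_rem (2 * n).+1 (x * h)) /\
    \int[nu]_x trig_rem (2 * n).+1 (x * h) = 0.
have step k : (forall h, integrable (fun x => trig_rem k (x * h)) /\
    \int[nu]_x trig_rem k (x * h) = 0) -> \int[nu]_x (x ^+ k) = 0.
  move=> Hk; have it h : integrable (fun x => trig_rem k (x * h)) by case: (Hk h).
  have L : (\int[nu]_x trig_rem k (x * h_ j)) / h_ j ^+ k @[j --> \oo] --> (0 : R).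
    by under eq_fun do rewrite (Hk _).2 mul0r; exact: cvg_cst.
  have : (\int[nu]_x (x ^+ k)) / k`!%:R = 0 := cvg_unique (@Rhausdorff R)
    (cvg_trig_rem_integral _ (integrable_exprn k) it) L.
  have F : (k`!%:R : R) != 0 by rewrite pnatr_eq0 -lt0n fact_gt0.
  by move=> M; rewrite -[LHS](divfK F) M mul0r.
have H : forall h, integrable (fun x => trig_rem (2 * n).+1 (x * h)) /\
    \int[nu]_x trig_rem (2 * n).+1 (x * h) = 0.
  elim: n => [|n IH] h; first by split; [case: (integrable_trig h)|exact: sin_phi].
  have [it Et] := IH h.
  have [it2 Et2] := trig_rem_integralS _ _ (integrable_exprn _) it.
  rewrite mulnS; split; first exact: it2.
  by rewrite Et2 (step _ IH) Et mul0r mulr0 subrr.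
by split => //; exact: step.
Qed.

End cosine_transform.
End moments.

(** * The gamma-grey measure and its orthogonal polynomials *)

Section incomplete_gamma_taylor.
Context {R : realType}.
Implicit Types (rho theta t : R).

Definition upper_gamma_deriv rho (k : nat) t : R :=
  if k is m.+1 then - powexp_deriv m (rho - 1) t else upper_gamma rho t.

Lemma is_derive_upper_gamma_deriv rho k t : 0 < rho -> 0 < t ->
  is_derive t 1 (upper_gamma_deriv rho k) (upper_gamma_deriv rho k.+1 t).
Proof.
move=> rho0 t0; case: k => [|k]; first exact: is_derive_upper_gamma.
exact: is_deriveN (is_derive_powexp_deriv k (rho - 1) t t0).
Qed.

(** The coefficient of [h ^+ (2 * k)] in the cosine transform; [2 ^+ k] comes from the increment
    [h ^+ 2 / 2]. *)
Definition gamma_ratio_coef rho theta (k : nat) : R :=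
  upper_gamma_deriv rho k theta / (k`!%:R * 2 ^+ k * upper_gamma rho theta).

Lemma gamma_ratio_taylor rho theta n : 0 < rho -> 0 < theta ->
  exists2 C : R, 0 <= C & forall h, 0 <= h <= 1 ->
    `|upper_gamma rho (theta + h ^+ 2 / 2) / upper_gamma rho theta -
      \sum_(k < n) gamma_ratio_coef rho theta k * h ^+ (2 * k)|
    <= C * h ^+ (2 * n).
Proof.
move=> rho0 theta0.
have U0 : 0 < upper_gamma rho theta by rewrite upper_gamma_gt0// ltW.
have [C C0 HC] := @taylor_bound R n (upper_gamma_deriv rho) theta
  (fun k x tx => is_derive_upper_gamma_deriv _ k _ rho0 (lt_le_trans theta0 tx)).
exists (C / upper_gamma rho theta); first by rewrite divr_ge0// ltW.
move=> h /andP[h0 h1].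
have h21 : h ^+ 2 <= 1 by rewrite expr_le1.
have h20 : 0 <= h ^+ 2 by rewrite sqr_ge0.
have eta01 : 0 <= h ^+ 2 / 2 <= 1 by apply/andP; split; lra.
have E : upper_gamma rho (theta + h ^+ 2 / 2) / upper_gamma rho theta -
      \sum_(k < n) gamma_ratio_coef rho theta k * h ^+ (2 * k) =
  (upper_gamma rho (theta + h ^+ 2 / 2) - \sum_(k < n)
    upper_gamma_deriv rho k theta / k`!%:R * (h ^+ 2 / 2) ^+ k) /
  upper_gamma rho theta.
  rewrite mulrBl mulr_suml; congr (_ - _); apply: eq_bigr => k _.
  rewrite /gamma_ratio_coef exprM expr_div_n.
  have jf : k`!%:R != 0 :> R by rewrite pnatr_eq0 -lt0n fact_gt0.
  have k2 : 2 ^+ k != 0 :> R by rewrite expf_neq0// pnatr_eq0.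
  have Un := lt0r_neq0 U0.
  by field; rewrite jf k2 Un.
rewrite E normrM normfV (gtr0_norm U0) [leRHS]mulrAC ler_pM2r ?invr_gt0//.
apply: le_trans (HC _ eta01) _; rewrite exprM ler_wpM2l// lerXn2r ?nnegrE//; lra.
Qed.

End incomplete_gamma_taylor.

(** * Gram-Schmidt up to degree three for a measure with vanishing odd moments *)

Section orthogonal_polynomials.
Context {R : realType} (nu : probability (measurableTypeR R) R).
Hypothesis integrable_monomial :
  forall k : nat, nu.-integrable [set: R] (fun x : R => (x ^+ k)%:E).
Implicit Types p q : {poly R}.

Let expect p : R := \int[nu]_x p.[x].

Let integrable_horner p : nu.-integrable [set: R] (fun x : R => p.[x]%:E).
Proof.
have H n : nu.-integrable [set: R] (fun x : R => (\sum_(i < n) p`_i * x ^+ i)%:E).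
  elim: n => [|n IH].
    under [X in nu.-integrable _ X]eq_fun do rewrite big_ord0.
    exact: (finite_measure_integrable_cst nu 0 measurableT).
  under [X in nu.-integrable _ X]eq_fun do rewrite big_ord_recr/=.
  exact: (@integrableD _ _ _ nu _ measurableT _ _ IH
    (integrableZl measurableT p`_n (integrable_monomial n))).
under [X in nu.-integrable _ X]eq_fun do rewrite horner_coef.
exact: H.
Qed.

Let expectD p q : expect (p + q) = expect p + expect q.
Proof.
rewrite /expect -RintegralD//; try exact: integrable_horner.
by apply: eq_Rintegral => x _; rewrite hornerD.
Qed.

Let expectZ (a : R) p : expect (a *: p) = a * expect p.
Proof.
rewrite /expect -RintegralZl//; last exact: integrable_horner.
by apply: eq_Rintegral => x _; rewrite hornerZ.
Qed.

Let expectB p q : expect (p - q) = expect p - expect q.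
Proof. by rewrite -scaleN1r expectD expectZ mulN1r. Qed.

Let inner_expect p q : L2_inner nu p q = expect (p * q).
Proof. by apply: eq_Rintegral => x _; rewrite hornerM. Qed.

Let expectXn k : expect 'X^k = \int[nu]_x (x ^+ k).
Proof. by apply: eq_Rintegral => x _; rewrite hornerXn. Qed.

Let expect1 : expect 1 = 1.
Proof.
rewrite /expect; under eq_Rintegral do rewrite hornerC.
rewrite Rintegral_cst//= (_ : fine _ = 1) ?mulr1//.
exact: (congr1 fine (probability_setT nu)).
Qed.

Let gram_schmidtS n (s := gram_schmidt_seq (L2_inner nu) (fun k => 'X^k) n) :
  gram_schmidt_seq (L2_inner nu) (fun k => 'X^k) n.+1 =
    rcons s ('X^n - \sum_(h <- s)
      (L2_inner nu 'X^n h / L2_inner nu h h) *: h).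
Proof. by []. Qed.

Variables m2 m4 : R.
Hypothesis odd_moments : forall n : nat, \int[nu]_x (x ^+ (2 * n).+1) = 0.
Hypothesis moment2 : \int[nu]_x (x ^+ 2) = m2.
Hypothesis moment4 : \int[nu]_x (x ^+ 4) = m4.
Hypothesis m2_neq0 : m2 != 0.
Hypothesis m4_neq : m4 - m2 ^+ 2 != 0.

Let expectX : expect 'X = 0.
Proof. by have := odd_moments 0; rewrite -expectXn expr1. Qed.
Let expectX2 : expect 'X^2 = m2. Proof. by rewrite expectXn. Qed.
Let expectX3 : expect 'X^3 = 0. Proof. by have := odd_moments 1; rewrite -expectXn. Qed.
Let expectX4 : expect 'X^4 = m4. Proof. by rewrite expectXn. Qed.
Let expectX5 : expect 'X^5 = 0. Proof. by have := odd_moments 2; rewrite -expectXn. Qed.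

Let H2 : {poly R} := 'X^2 - m2%:P.

Let m2E : m2%:P = m2 *: (1 : {poly R}).
Proof. by rewrite -mul_polyC mulr1. Qed.

Let inner11 : L2_inner nu 1 1 = 1.
Proof. by rewrite inner_expect mulr1 expect1. Qed.

Let innerXX : L2_inner nu 'X 'X = m2.
Proof. by rewrite inner_expect -expr2 expectX2. Qed.

Let inner22 : L2_inner nu H2 H2 = m4 - m2 ^+ 2.
Proof.
have -> : L2_inner nu H2 H2 = expect ('X^4 - (m2 *: 'X^2 + m2 *: 'X^2) + m2 *: (m2 *: 1)).
  rewrite inner_expect; congr expect; rewrite /H2 m2E -!mul_polyC.
  by ring.
rewrite expectD expectB expectD !expectZ expectX4 expectX2 expect1; ring.
Qed.

(** Products of polynomials of opposite parity have zero integral, so ['X^2] is corrected only along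
    [1] and ['X^3] only along ['X]. *)
Lemma ortho_polyE : [/\ ortho_poly nu 0 = 1, ortho_poly nu 1 = 'X,
  ortho_poly nu 2 = 'X^2 - m2%:P & ortho_poly nu 3 = 'X^3 - (m4 / m2) *: 'X].
Proof.
have s1 : gram_schmidt_seq (L2_inner nu) (fun k => 'X^k) 1 = [:: 1].
  by rewrite gram_schmidtS/= big_nil subr0 expr0.
have s2 : gram_schmidt_seq (L2_inner nu) (fun k => 'X^k) 2 = [:: 1; 'X].
  rewrite gram_schmidtS s1 big_seq1 inner_expect mulr1 expr1 expectX.
  by rewrite mul0r scale0r subr0.
have s3 : gram_schmidt_seq (L2_inner nu) (fun k => 'X^k) 3 = [:: 1; 'X; H2].
  rewrite gram_schmidtS s2 big_cons big_seq1 !inner_expect !mulr1 expect1.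
  by rewrite expectX2 -exprSr expectX3 divr1 mul0r scale0r addr0 -m2E.
have s4 : gram_schmidt_seq (L2_inner nu) (fun k => 'X^k) 4 =
    [:: 1; 'X; H2; 'X^3 - (m4 / m2) *: 'X].
  rewrite gram_schmidtS s3 2!big_cons big_seq1 (inner_expect 'X^3) mulr1.
  rewrite expectX3 mul0r scale0r add0r innerXX !(inner_expect 'X^3) -exprSr expectX4.
  have -> : 'X^3 * H2 = 'X^5 - m2 *: 'X^3.
    by rewrite /H2 -mul_polyC; ring.
  by rewrite expectB expectZ expectX5 expectX3 mulr0 subrr mul0r scale0r addr0.
by split; rewrite /ortho_poly /gram_schmidt (s1, s2, s3, s4).
Qed.

(** Division by [0] returns [0], so this is what makes the Gram-Schmidt quotients genuine
    projections. The three values are [1], [m2] and the variance of [x ^ 2]. *)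
Lemma ortho_poly_inner n : (n < 3)%N ->
  L2_inner nu (ortho_poly nu n) (ortho_poly nu n) != 0.
Proof.
have [H0 H1 H2' _] := ortho_polyE; case: n => [|[|[|//]]] _.
- by rewrite H0 inner11 oner_neq0.
- by rewrite H1 innerXX.
- by rewrite H2' inner22.
Qed.

Lemma size_ortho_poly n : (n < 4)%N -> size (ortho_poly nu n) = n.+1.
Proof.
have [H0 H1 H2' H3] := ortho_polyE; case: n => [|[|[|[|//]]]] _.
- by rewrite H0 size_poly1.
- by rewrite H1 size_polyX.
- by rewrite H2' size_polyDl size_polyXn// size_polyN (leq_ltn_trans (size_polyC_leq1 _)).
- rewrite H3 size_polyDl size_polyXn// size_polyN.
  by apply: leq_ltn_trans (size_scale_leq _ _) _; rewrite size_polyX.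
Qed.

End orthogonal_polynomials.

(* If the variance of [x ^ 2] vanished, [nu] would be carried by [-s] and [s]
   with [s ^ 2 = m2], hence its cosine transform would be -1 at [pi / s]. *)
Lemma variance_square_neq0 (R : realType)
    (nu : probability (measurableTypeR R) R) (m2 m4 : R) :
  (forall k : nat, nu.-integrable [set: R] (fun x : R => (x ^+ k)%:E)) ->
  \int[nu]_x (x ^+ 2) = m2 -> \int[nu]_x (x ^+ 4) = m4 -> 0 < m2 ->
  (forall xi : R, -1 < \int[nu]_x cos (x * xi)) -> m4 - m2 ^+ 2 != 0.
Proof.
move=> ik e2 e4 m20 cosN1; apply/eqP => var0.
have iZ a k : nu.-integrable [set: R] (fun x : R => (a * x ^+ k)%:E).
  exact: (integrableZl measurableT a (ik k)).
pose s := Num.sqrt m2.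
have s0 : 0 < s by rewrite sqrtr_gt0.
have s2 : s ^+ 2 = m2 by rewrite sqr_sqrtr// ltW.
pose C := (pi / s / s) ^+ 2 / 2.
(* The right side is [C * (x ^ 2 - m2) ^ 2], whose integral is [C] times the variance. For
   [z = |x| * pi / s - pi] the left side is [1 - cos z <= z ^ 2 / 2], and the factor
   [((|x| + s) / s) ^ 2 >= 1] completes the square; this fixes [C]. *)
have bound x : 1 + cos (x * (pi / s)) <= C * (x ^+ 4 - 2 * m2 * x ^+ 2 + m2 ^+ 2).
  set z := `|x * (pi / s)| - pi.
  have -> : cos (x * (pi / s)) = - cos z.
    by rewrite /z cosB cospi sinpi mulr0 addr0 mulrN1 opprK cos_norm.
  have le_z : 1 - cos z <= z ^+ 2 / 2.
    have := norm_trig_rem_le 2 z; rewrite trig_remSS expr0 fact0 divr1 real_normK ?num_real//.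
    exact: le_trans (ler_norm _).
  apply: le_trans le_z _.
  have zE : z = pi / s * (`|x| - s).
    rewrite /z normrM [`|pi / s|]gtr0_norm ?divr_gt0 ?pi_gt0//.
    by field; rewrite gt_eqF.
  have -> : x ^+ 4 - 2 * m2 * x ^+ 2 + m2 ^+ 2 = (`|x| - s) ^+ 2 * (`|x| + s) ^+ 2.
    rewrite -exprMn -subr_sqr real_normK ?num_real// s2; ring.
  have -> : C * ((`|x| - s) ^+ 2 * (`|x| + s) ^+ 2) =
      z ^+ 2 / 2 * ((`|x| + s) ^+ 2 / s ^+ 2).
    by rewrite zE /C; field; rewrite gt_eqF.
  apply: ler_peMr; first by rewrite divr_ge0 ?sqr_ge0.
  rewrite ler_pdivlMr ?exprn_gt0// mul1r lerXn2r ?nnegrE ?addr_ge0 ?(ltW s0)//.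
  by rewrite lerDr.
have i1 : nu.-integrable [set: R] (EFin \o cst (1 : R)).
  exact: (finite_measure_integrable_cst nu 1 measurableT).
have im2 : nu.-integrable [set: R] (EFin \o cst (m2 ^+ 2)).
  exact: (finite_measure_integrable_cst nu (m2 ^+ 2) measurableT).
have [ic _] := integrable_trig nu (pi / s).
have nu1 : fine (nu [set: R]) = 1 by exact: (congr1 fine (probability_setT nu)).
have icos1 : nu.-integrable [set: R] (EFin \o (fun x => 1 + cos (x * (pi / s)))).
  exact: (integrableD measurableT i1 ic).
have iB : nu.-integrable [set: R] (EFin \o (fun x => x ^+ 4 - 2 * m2 * x ^+ 2)).
  exact: (integrableB measurableT (ik 4%N) (iZ (2 * m2) 2%N)).
have iD : nu.-integrable [set: R]
    (EFin \o (fun x => x ^+ 4 - 2 * m2 * x ^+ 2 + m2 ^+ 2)).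
  exact: (integrableD measurableT iB im2).
have := @le_Rintegral _ _ _ nu _ _ _ measurableT icos1
  (integrableZl measurableT C iD) (fun x _ => bound x).
rewrite RintegralD// RintegralZl// RintegralD// RintegralB//; last 2 first.
- exact: (ik 4%N).
- exact: (iZ (2 * m2) 2%N).
rewrite RintegralZl//; last exact: (ik 2%N).
rewrite e4 e2 !Rintegral_cst// nu1 !mulr1.
have -> : m4 - 2 * m2 * m2 + m2 ^+ 2 = 0 by rewrite -var0; ring.
by rewrite mulr0 leNgt -ltrBlDl sub0r cosN1.
Qed.

Theorem lemma2p1 (R : realType) (rho theta : R)
    (rho_gt0 : 0 < rho) (rho_le1 : rho <= 1) (theta_gt0 : 0 < theta)
    (nu : probability (measurableTypeR R) R)
    (nuP : is_gamma_grey rho theta nu) :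
  [/\ forall k : nat, nu.-integrable [set: R] (fun x : R => (x ^+ k)%:E),
      forall n : nat, \int[nu]_x (x ^+ (2 * n).+1) = 0,
      forall n : nat, (1 <= n)%N ->
        \int[nu]_x (x ^+ (2 * n)) =
        (-1) ^+ n.+1 * (2 * n)`!%:R * Gamma rho * theta `^ (rho - n%:R) /
          (n`!%:R * 2 ^+ n * upper_gamma rho theta) *
        prabhakar rho 1 (rho + 1 - n%:R) (- theta)
    & [/\ (forall n : nat, (n < 4)%N -> size (ortho_poly nu n) = n.+1),
          (* no division by zero occurs in the first four Gram-Schmidt steps *)
          (forall n : nat, (n < 3)%N ->
            L2_inner nu (ortho_poly nu n) (ortho_poly nu n) != 0)
        & [/\ ortho_poly nu 0 = 1,
          ortho_poly nu 1 = 'X,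
          ortho_poly nu 2 =
            'X^2 - (theta `^ (rho - 1) * expR (- theta) /
                     upper_gamma rho theta)%:P
        & ortho_poly nu 3 =
            'X^3 - (3 * (1 + (1 - rho) * theta^-1)) *: 'X]]].
Proof.
pose phi h := upper_gamma rho (theta + h ^+ 2 / 2) / upper_gamma rho theta.
have U0 : 0 < upper_gamma rho theta by rewrite upper_gamma_gt0// ltW.
have phi0 xi : 0 < phi xi.
  by rewrite divr_gt0// upper_gamma_gt0// addr_ge0 ?(ltW theta_gt0)// divr_ge0 ?sqr_ge0.
(* Real and imaginary parts of the identity for the characteristic function. *)
have cos_phi xi : \int[nu]_x cos (x * xi) = phi xi by case: (nuP xi).
have sin_phi xi : \int[nu]_x sin (x * xi) = 0 by case: (nuP xi).
have phi_taylor n := gamma_ratio_taylor rho theta n rho_gt0 theta_gt0.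
have ik := integrable_exprn nu phi _ cos_phi phi_taylor.
have odd := odd_moment nu phi _ cos_phi sin_phi phi_taylor.
have even n := (even_moment nu phi _ cos_phi phi_taylor n).2.
have e2 : \int[nu]_x (x ^+ 2) =
    theta `^ (rho - 1) * expR (- theta) / upper_gamma rho theta.
  rewrite (even 1%N) /gamma_ratio_coef/=.
  rewrite (_ : (2 * 1)`!%:R = 2 :> R)// (_ : 1`!%:R = 1 :> R)//.
  by field; rewrite gt_eqF.
set m2 := _ / _ in e2.
have m20 : 0 < m2 by rewrite divr_gt0// mulr_gt0 ?powR_gt0 ?expR_gt0.
(* Factored so that the ratio of the fourth to the second moment is the coefficient of ['X] in the
   cubic polynomial. *)
have e4 : \int[nu]_x (x ^+ 4) = m2 * (3 * (1 + (1 - rho) * theta^-1)).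
  rewrite (even 2%N) /gamma_ratio_coef/= /m2.
  rewrite (_ : (2 * 2)`!%:R = 24 :> R)// (_ : 2`!%:R = 2 :> R)//.
  have -> : theta `^ (rho - 1) = theta `^ (rho - 1 - 1) * theta.
    rewrite -[X in _ * X]powRr1 ?ltW// -powRD ?subrK//.
    by rewrite (gt_eqF theta_gt0) implybT.
  by field; rewrite !gt_eqF.
have var := variance_square_neq0 R nu _ _ ik e2 e4 m20.
(* The cosine transform is a quotient of positive values, so it never reaches [-1]. *)
have {}var : m2 * (3 * (1 + (1 - rho) * theta^-1)) - m2 ^+ 2 != 0.
  by apply: var => xi; rewrite cos_phi; apply: lt_trans (phi0 xi); rewrite ltrN10.
have m2n := lt0r_neq0 m20.
split => //.
  (* The minus sign in the derivative of the incomplete gamma function turns [(-1) ^+ n] into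
     [(-1) ^+ n.+1]. *)
  case=> // m _; rewrite (even m.+1) /gamma_ratio_coef /upper_gamma_deriv.
  rewrite -(prabhakar_powexp_deriv rho theta m)// [in RHS]exprS.
  rewrite mulN1r !mulNr !mulrN !mulrA; congr (- _).
  by rewrite -!mulrA; congr (_ * (_ * _)); rewrite !mulrA mulrAC.
have [H0 H1 H2 H3] := ortho_polyE nu ik _ _ odd e2 e4.
split.
- exact: (size_ortho_poly nu ik _ _ odd e2 e4).
- exact: (ortho_poly_inner nu ik _ _ odd e2 e4 m2n var).
- by split => //; rewrite H3 mulrAC divff// mul1r.
Qed.
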